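(* Let $G$ and $H$ be graphs on $m$ and $n$ vertices respectively, and let $u$ be a vertex of $G$ whose degree $d_u$ in $G$ satisfies $d_u\notin\sigma_u(G)$. Then $\uparrow^{2}(G\vee H)$ has Laplacian perfect state transfer between $(0,u)$ and $(1,u)$ if and only if $\sigma_u(G)\subset\mathbb{Z}$ and one of the following holds: (1) $G$ is connected, $\nu_2(m+n)>\nu_2(d_u+n)$, and $\nu_2(\lambda+n)>\nu_2(d_u+n)$ for all $\lambda\in\sigma_u(G)\setminus \{0\}$; (2) $G$ is disconnected, $u$ is not an isolated vertex of $G$, $\nu_2(n)>\nu_2(d_u+n)$, $\nu_2(m+n)>\nu_2(d_u+n)$, and $\nu_2(\lambda+n)>\nu_2(d_u+n)$ for all $\lambda\in\sigma_u(G)\setminus \{0\}$. Moreover, the minimum time of Laplacian perfect state transfer is $\tau = \frac{\pi}{2h}$ with $h=\gcd(S)$, where $S=\{\lambda+n:\lambda\in(\sigma_u(G)\setminus \{0\})\cup \{d_u,m\}\}$ if (1) holds, and $S=\{\lambda+n:\lambda\in\sigma_u(G)\cup \{d_u,m\}\}$ otherwise.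
   Context: All graphs are simple, undirected and unweighted. The join $G\vee H$ is obtained from the disjoint union of $G$ and $H$ by adding all edges between $V(G)$ and $V(H)$. $\sigma_u(G)$ is the Laplacian eigenvalue support of $u$ in $G$: the set of distinct eigenvalues $\lambda$ of the Laplacian $L=D-A$ of $G$ with $E_\lambda\mathbf{e}_u\neq\mathbf{0}$, $E_\lambda$ the orthogonal projection onto the $\lambda$-eigenspace. For a nonzero integer $n$, $\nu_2(n)$ is the exponent of the largest power of $2$ dividing $n$. The blow-up $\uparrow^{2}X$ has vertex set $\mathbb{Z}_2\times V(X)$, with $(l,a)\sim(m,b)$ iff $a\sim b$ in $X$. A graph with Laplacian $L$ has Laplacian perfect state transfer between vertices $a,b$ at time $\tau>0$ if $\exp(i\tau L)\mathbf{e}_a=\gamma\mathbf{e}_b$ for some $\gamma\in\mathbb{C}$. *)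

(* Defs.v *)
From HB Require Import structures.
From mathcomp Require Import all_boot all_order all_algebra.
From mathcomp Require Import all_classical all_reals all_analysis.
From mathcomp Require Import complex.
Set Implicit Arguments. Unset Strict Implicit. Unset Printing Implicit Defensive.
Import Order.TTheory GRing.Theory Num.Theory.
Import numFieldNormedType.Exports.
Local Open Scope ring_scope.

Definition simple_graph (V : finType) (e : rel V) : Prop :=
  symmetric e /\ irreflexive e.

Definition deg (V : finType) (e : rel V) (u : V) : nat := #|[set v | e u v]|.

Definition connected_graph (V : finType) (e : rel V) : Prop :=
  forall x y : V, connect e x y.

Definition join (V W : finType) (eG : rel V) (eH : rel W) : rel (V + W)%type :=
  fun x y => match x, y with
             | inl a, inl b => eG a b
             | inr a, inr b => eH a b
             | _, _ => true
             end.

Definition blowup2 (X : finType) (e : rel X) : rel ('I_2 * X)%type :=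
  fun p q => e p.2 q.2.

Definition laplacian (R : realType) (V : finType) (e : rel V) : 'M[R]_#|V| :=
  \matrix_(i, j) (if i == j then (deg e (enum_val i))%:R
                  else if e (enum_val i) (enum_val j) then -1 else 0).

Definition orth_proj_eigen (R : realType) (N : nat) (L : 'M[R]_N) (lam : R)
  (P : 'M[R]_N) : Prop :=
  P^T = P /\ P *m P = P /\ (P == eigenspace L lam)%MS.

Definition eig_support (R : realType) (V : finType) (e : rel V) (u : V) (lam : R)
  : Prop :=
  exists P, orth_proj_eigen (laplacian R e) lam P /\
            (delta_mx 0 (enum_rank u) : 'rV[R]_#|V|) *m P != 0.

Definition expiL (R : realType) (N : nat) (t : R) (L : 'M[R]_N) : 'M[R[i]]_N :=
  \matrix_(i, j)
    let s := fun K : nat => \sum_(k < K)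
               ((Complex 0 t) ^+ k / (k`!)%:R * Complex ((L ^+ k) i j) 0) in
    Complex (limn (fun K : nat => (complex.Re (s K) : R))) (limn (fun K : nat => (complex.Im (s K) : R))).

Definition evec (R : realType) (V : finType) (a : V) : 'cV[R[i]]_#|V| :=
  delta_mx (enum_rank a) 0.

Definition lap_pst (R : realType) (V : finType) (e : rel V) (a b : V) (t : R) : Prop :=
  0 < t /\ exists g : R[i],
    expiL t (laplacian R e) *m evec R a = g *: evec R b.

Definition min_pst_time (R : realType) (V : finType) (e : rel V) (a b : V) (t : R)
  : Prop :=
  lap_pst e a b t /\ forall s : R, 0 < s -> s < t -> ~ lap_pst e a b s.

Definition nu2 (z : int) : nat := logn 2 `|z|%N.

Definition divides_real (R : realType) (d : nat) (s : R) : Prop :=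
  exists k : int, s = k%:~R * d%:R.
Definition is_gcd_set (R : realType) (S : R -> Prop) (h : nat) : Prop :=
  (forall s, S s -> divides_real h s) /\
  (forall d : nat, (forall s, S s -> divides_real d s) -> (d %| h)%N).

(* Main.v *)
Require Import Defs.
From HB Require Import structures.
From mathcomp Require Import all_boot all_order all_algebra.
From mathcomp Require Import all_classical all_reals all_analysis.
From mathcomp Require Import complex.
From mathcomp Require Import algC algnum.
From mathcomp Require Import ring lra.
Set Implicit Arguments. Unset Strict Implicit. Unset Printing Implicit Defensive.
Import Order.TTheory GRing.Theory Num.Theory.
Import numFieldNormedType.Exports.
Local Open Scope ring_scope.

(** The antisymmetric combination [e_(0,u) - e_(1,u)] is an eigenvector of the
    Laplacian of the blow-up of [e], with eigenvalue [2 d] for [d] the degree of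
    [u], while on vectors symmetric under the swap the Laplacian acts as twice
    that of [e].  Expanding [e_(0,u)] in these two parts, perfect state transfer
    at time [t] means that [2 t mu / pi] is an even integer for every [mu] in the
    support of [u] (the eigenvalue [0] forces the phase to be [1]) and that
    [2 t d / pi] is an odd integer.  With [d > 0] this makes the support rational,
    hence integral, and turns the condition into a comparison of 2-adic
    valuations; the least such [2 t / pi] is then the inverse of the gcd.  For a
    join, the support of [u] is read off from that of [G], the eigenvalue [n]
    occurring exactly when the component of [u] is proper. *)

(** * The exponential of a real symmetric matrix *)

(** This is [e^(ix)], given by its two components because [expiL] takes the limits of the real and
    imaginary parts separately. *)
Definition expi {R : realType} (x : R) : R[i] := Complex (cos x) (sin x).

(** The shape is that of [cos_coeff] and [sin_coeff] before division by [k!]. *)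
Lemma expr_imaginary (R : realType) (t : R) k :
  (Complex 0 t) ^+ k = Complex ((~~ odd k)%:R * (-1) ^+ k./2 * t ^+ k)
                               ((odd k)%:R * (-1) ^+ k.-1./2 * t ^+ k).
Proof.
elim: k => [|k IHk]; first by rewrite !expr0 /= !mul1r !mul0r.
rewrite exprS IHk; apply/eqP; rewrite eq_complex /=; apply/andP; split; apply/eqP.
  rewrite mul0r sub0r negbK exprS uphalf_half.
  case: k {IHk} => [|k] /=; first by rewrite !mul0r mulr0 oppr0.
  rewrite uphalf_half; case: (odd k) => /=; rewrite ?add0n ?add1n ?exprS; ring.
by rewrite mul0r add0r exprS; ring.
Qed.

Lemma expi_termE (R : realType) (t : R) k :
  (Complex 0 t) ^+ k / (k`!)%:R = Complex (cos_coeff t k) (sin_coeff t k).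
Proof.
rewrite expr_imaginary -(rmorph_nat (real_complex R)) -fmorphV /=.
apply/eqP; rewrite eq_complex /= !mulr0 subr0 add0r.
by apply/andP; split; apply/eqP.
Qed.

Lemma expi_partial_sumE (R : realType) (t : R) K :
  \sum_(k < K) (Complex 0 t) ^+ k / (k`!)%:R =
  Complex (series (cos_coeff t) K) (series (sin_coeff t) K).
Proof.
rewrite /series /= !big_mkord; under eq_bigr do rewrite expi_termE.
elim: K => [|K IHK]; first by rewrite !big_ord0.
by rewrite !big_ord_recr /= IHK.
Qed.

Lemma cvg_cos_series (R : realType) (t : R) : (series (cos_coeff t) @ \oo --> cos t)%classic.
Proof. by rewrite unlock; exact: is_cvg_series_cos_coeff. Qed.

Lemma cvg_sin_series (R : realType) (t : R) : (series (sin_coeff t) @ \oo --> sin t)%classic.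
Proof. by rewrite unlock; exact: is_cvg_series_sin_coeff. Qed.

(** After diagonalization each entry of [expiL] is such a finite combination of scalar exponential
    series, so its limit reduces to the series of cosine and sine. *)
Lemma limn_exp_combination (R : realType) (I : finType) (c : I -> R[i]) (x : I -> R)
    (s : nat -> R[i]) :
  (forall K, s K = \sum_l c l * \sum_(k < K) (Complex 0 (x l)) ^+ k / (k`!)%:R) ->
  Complex (limn (fun K => complex.Re (s K) : R)) (limn (fun K => complex.Im (s K) : R)) =
  \sum_l c l * expi (x l).
Proof.
move=> sE.
have ReD (I' : finType) (F : I' -> R[i]) :
    complex.Re (\sum_l F l) = \sum_l complex.Re (F l).
  by elim/big_rec2: _ => // l a b _ <-; case: (F l) b => ? ? [].
have ImD (I' : finType) (F : I' -> R[i]) :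
    complex.Im (\sum_l F l) = \sum_l complex.Im (F l).
  by elim/big_rec2: _ => // l a b _ <-; case: (F l) b => ? ? [].
apply/eqP; rewrite eq_complex; apply/andP; split; apply/eqP.
  rewrite ReD /=; apply/cvg_lim => //.
  rewrite (_ : (fun K => _) = (fun K => \sum_l (complex.Re (c l) * series (cos_coeff (x l)) K
     - complex.Im (c l) * series (sin_coeff (x l)) K))); last first.
    apply/funext => K; rewrite sE ReD; apply: eq_bigr => l _.
    by rewrite expi_partial_sumE; case: (c l).
  apply: (cvg_big (fun xy => add_continuous xy)) => l _.
  rewrite (_ : complex.Re (c l * expi (x l)) = complex.Re (c l) * cos (x l)
     - complex.Im (c l) * sin (x l)); last by case: (c l).
  by apply: cvgB; (apply: cvgM; first exact: cvg_cst);
    [exact: cvg_cos_series | exact: cvg_sin_series].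
rewrite ImD /=; apply/cvg_lim => //.
rewrite (_ : (fun K => _) = (fun K => \sum_l (complex.Re (c l) * series (sin_coeff (x l)) K
     + complex.Im (c l) * series (cos_coeff (x l)) K))); last first.
  apply/funext => K; rewrite sE ImD; apply: eq_bigr => l _.
  by rewrite expi_partial_sumE; case: (c l).
apply: (cvg_big (fun xy => add_continuous xy)) => l _.
rewrite (_ : complex.Im (c l * expi (x l)) = complex.Re (c l) * sin (x l)
     + complex.Im (c l) * cos (x l)); last by case: (c l).
by apply: cvgD; (apply: cvgM; first exact: cvg_cst);
  [exact: cvg_sin_series | exact: cvg_cos_series].
Qed.

(** A real symmetric matrix is Hermitian over [R[i]], where the spectral theorem applies; its
    eigenvalues are real, but [U] is in general complex. *)
Lemma real_symmetric_spectral (R : realType) N (L : 'M[R]_N) : L^T = L ->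
  exists (U : 'M[R[i]]_N) (d : 'rV[R]_N), U \in unitmx /\
    map_mx (real_complex R) L =
      invmx U *m diag_mx (map_mx (real_complex R) d) *m U.
Proof.
move=> Lsym; set A := map_mx _ L.
have Areal : A \is a mxOver Num.real.
  by apply/mxOverP => i j; rewrite mxE; apply/complex_realP; exists (L i j).
have Aherm : A \is hermitianmx _ false Num.conj.
  apply: realsym_hermsym => //; apply/is_hermitianmxP.
  by rewrite expr0 scale1r map_mx_id // /A map_trmx Lsym.
exists (spectralmx A), (map_mx (@complex.Re R) (spectral_diag A)).
split; first exact: spectral_unit.
rewrite -map_mx_comp (_ : map_mx _ (spectral_diag A) = spectral_diag A).
  exact/orthomx_spectralP/hermitian_normalmx.
apply/matrixP => i j; rewrite mxE /= RRe_real //.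
exact/mxOverP/hermitian_spectral_diag_real.
Qed.

Lemma expmx_diagonalization (F : comUnitRingType) n (A U : 'M[F]_n) (d : 'rV[F]_n) k :
  U \in unitmx -> A = invmx U *m diag_mx d *m U ->
  A ^+ k = invmx U *m diag_mx (map_mx (fun x => x ^+ k) d) *m U.
Proof.
move=> Uunit AE; elim: k => [|k IHk].
  rewrite expr0 (_ : diag_mx _ = 1%:M) ?mulmx1 ?mulVmx //.
  by apply/matrixP => i j; rewrite !mxE expr0.
rewrite exprS (_ : A * A ^+ k = A *m A ^+ k) // IHk AE !mulmxA mulmxK //.
rewrite -[_ *m diag_mx d *m _]mulmxA mulmx_diag; congr (_ *m diag_mx _ *m _).
by apply/rowP => j; rewrite !mxE exprS.
Qed.

Lemma map_mxX (aR rR : pzRingType) (f : {rmorphism aR -> rR}) n (A : 'M[aR]_n) k :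
  map_mx f (A ^+ k) = map_mx f A ^+ k.
Proof.
elim: k => [|k IHk]; first by rewrite !expr0 map_mx1.
by rewrite !exprS -IHk map_mxM.
Qed.

Lemma expiL_diagonalization (R : realType) N (t : R) (L : 'M[R]_N)
    (U : 'M[R[i]]_N) (d : 'rV[R]_N) : U \in unitmx ->
  map_mx (real_complex R) L =
    invmx U *m diag_mx (map_mx (real_complex R) d) *m U ->
  expiL t L = invmx U *m diag_mx (map_mx (fun x => expi (t * x)) d) *m U.
Proof.
move=> Uunit LE.
have sandwich (D : 'rV[R[i]]_N) i j : (invmx U *m diag_mx D *m U) i j =
    \sum_l (invmx U i l * U l j) * D 0 l.
  rewrite mxE; apply: eq_bigr => l _; rewrite mul_mx_diag mxE; ring.
apply/matrixP => i j; rewrite sandwich mxE /=.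
rewrite (@limn_exp_combination R _ (fun l => invmx U i l * U l j) (fun l => t * d 0 l)).
  by apply: eq_bigr => l _; rewrite mxE.
move=> K; under [RHS]eq_bigr do rewrite mulr_sumr.
rewrite exchange_big /=; apply: eq_bigr => k _.
have /matrixP/(_ i j) := map_mxX (real_complex R) L k.
rewrite (expmx_diagonalization k Uunit LE) mxE sandwich.
rewrite -[Complex _ 0]/(real_complex R _) => ->.
rewrite mulr_sumr; apply: eq_bigr => l _; rewrite !mxE.
rewrite (_ : Complex 0 (t * d 0 l) = Complex 0 t * real_complex R (d 0 l)).
  by rewrite exprMn; ring.
by apply/eqP; rewrite eq_complex /= !mulr0 !mul0r subr0 add0r !eqxx.
Qed.

Lemma expiL_eigenvector (R : realType) N (t : R) (L : 'M[R]_N) (w : 'rV[R]_N) mu :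
  L^T = L -> w *m L = mu *: w ->
  map_mx (real_complex R) w *m expiL t L =
    expi (t * mu) *: map_mx (real_complex R) w.
Proof.
move=> /real_symmetric_spectral [U [d [Uunit LE]]] wL.
rewrite (expiL_diagonalization _ Uunit LE) !mulmxA.
set y := _ *m invmx U; rewrite -[X in _ = _ *: X](mulmxKV Uunit) -/y scalemxAl.
congr (_ *m _).
have yD : y *m diag_mx (map_mx (real_complex R) d) = real_complex R mu *: y.
  apply: (can_inj (mulmxK Uunit)); rewrite /y -!mulmxA [invmx U *m (_ *m U)]mulmxA.
  by rewrite -LE -map_mxM wL map_mxZ -scalemxAl mulmxKV.
(* Entrywise, either [y] vanishes at [l] or [d 0 l = mu]; the two sides agree in both cases. *)
apply/rowP => l; have /rowP/(_ l) := yD.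
rewrite !mul_mx_diag !mxE => /eqP; rewrite mulrC -subr_eq0 -mulrBl mulf_eq0.
case/orP => [|/eqP ->]; last by rewrite mulr0 mul0r.
by rewrite -rmorphB fmorph_eq0 subr_eq0 => /eqP ->; rewrite mulrC.
Qed.

(** The rows of the diagonalizing matrix are complex left eigenvectors with real eigenvalues. Since
    [L] is real, their real and imaginary parts satisfy the same equation, so real test vectors
    suffice. *)
Lemma eigenvectors_separate (R : realType) N (L : 'M[R]_N) (z : 'cV[R[i]]_N) :
  L^T = L ->
  (forall (w : 'rV[R]_N) mu, w *m L = mu *: w -> map_mx (real_complex R) w *m z = 0) ->
  z = 0.
Proof.
move=> /real_symmetric_spectral [U [d [Uunit LE]]] zE.
rewrite -[z](mulKmx Uunit) (_ : U *m z = 0) ?mulmx0 //.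
apply/row_matrixP => l; rewrite row_mul row0.
pose toC := real_complex R.
have UL : row l U *m map_mx toC L = toC (d 0 l) *: row l U.
  by rewrite LE !mulmxA -row_mul mulmxV // row1 -mulmxA -rowE row_mul row_diag_mx
    -scalemxAl mxE -rowE.
pose wr := map_mx (@complex.Re R) (row l U); pose wi := map_mx (@complex.Im R) (row l U).
have UE : row l U = map_mx toC wr + Complex 0 1 *: map_mx toC wi.
  by apply/rowP => j; rewrite !mxE [LHS]complexE.
have eig : map_mx toC (wr *m L - d 0 l *: wr) +
    Complex 0 1 *: map_mx toC (wi *m L - d 0 l *: wi) = 0.
  rewrite !map_mxB !map_mxM !map_mxZ scalerBr addrACA -opprD.
  rewrite scalerA mulrC -scalerA -scalerDr -UE scalemxAl -mulmxDl -UE.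
  by apply/eqP; rewrite subr_eq0 UL.
have wrL : wr *m L = d 0 l *: wr.
  apply/eqP; rewrite -subr_eq0; apply/eqP/rowP => j.
  have /rowP/(_ j) := eig; rewrite !mxE => /(congr1 (@complex.Re R)) /=.
  by rewrite mul0r mulr0 subrr addr0.
have wiL : wi *m L = d 0 l *: wi.
  apply/eqP; rewrite -subr_eq0; apply/eqP/rowP => j.
  have /rowP/(_ j) := eig; rewrite !mxE => /(congr1 (@complex.Im R)) /=.
  by rewrite mul0r mul1r !add0r.
by rewrite UE mulmxDl -scalemxAl (zE _ _ wrL) (zE _ _ wiL) scaler0 addr0.
Qed.

(** * Orthogonal projections onto eigenspaces *)

(** If [v] is killed by the Gram matrix, then [v B] has squared norm zero, and freeness of the rows
    gives [v = 0]. *)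
Lemma gram_unitmx (F : realFieldType) m n (B : 'M[F]_(m, n)) :
  row_free B -> B *m B^T \in unitmx.
Proof.
move=> Bfree; rewrite -row_free_unit -kermx_eq0; apply/rowV0P => v /sub_kermxP vG.
apply/eqP; rewrite -(mulmx_free_eq0 _ Bfree); apply/eqP.
have : (v *m B) *m (v *m B)^T = 0.
  by rewrite trmx_mul mulmxA -[v *m B *m _]mulmxA vG mul0mx.
move: (v *m B) => y /matrixP/(_ 0 0); rewrite !mxE => /eqP.
rewrite psumr_eq0; last by move=> i _; rewrite mxE -expr2 sqr_ge0.
move=> /allP yy; apply/rowP => j; rewrite mxE; apply/eqP.
by have := yy j; rewrite mem_index_enum mxE -expr2 sqrf_eq0; apply.
Qed.

(** For [B] whose rows form a basis of the eigenspace, the projection is [B^T (B B^T)^-1 B]. *)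
Lemma orth_proj_eigen_exists (R : realType) N (L : 'M[R]_N) lam :
  exists P, orth_proj_eigen L lam P.
Proof.
move: (row_base _) (row_base_free (eigenspace L lam)) (eq_row_base (eigenspace L lam)).
move=> B /gram_unitmx Bunit BE.
exists (B^T *m invmx (B *m B^T) *m B); split; last split.
- by rewrite !trmx_mul trmxK trmx_inv trmx_mul trmxK mulmxA.
- by rewrite !mulmxA -[_ *m B *m B^T]mulmxA mulmxK.
- apply/andP; split; first by rewrite -BE submxMl.
  by rewrite -BE; apply/submxP; exists B; rewrite !mulmxA mulmxV // mul1mx.
Qed.

(** * Laplacian eigenfunctions and the eigenvalue support *)

(** The eigenvector equation for functions on vertices, with [D - A] expanded over neighbours; it
    frees later arguments from the enumeration of the vertices. *)
Definition lap_eigen {R : realType} {V : finType} (e : rel V) (f : V -> R) (lam : R) :=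
  forall x, \sum_(y | e x y) (f x - f y) = lam * f x.

Lemma laplacian_mulE (R : realType) (V : finType) (e : rel V) (w : 'rV[R]_#|V|) x :
  simple_graph e -> (w *m laplacian R e) 0 (enum_rank x) =
    \sum_(y | e x y) (w 0 (enum_rank x) - w 0 (enum_rank y)).
Proof.
move=> [esym eirr]; rewrite mxE (reindex (@enum_rank V)) /=; last first.
  exact/onW_bij/enum_rank_bij.
under eq_bigr do rewrite mxE !enum_rankK (inj_eq enum_rank_inj).
rewrite (bigD1 x) //= eqxx sumrB sumr_const mulr_natr.
congr (_ *+ _ + _); first by rewrite /deg cardsE.
rewrite -sumrN [RHS]big_mkcond /= [RHS](bigD1 x) //= eirr add0r.
apply: eq_bigr => y /negPf yx; rewrite yx esym.
by case: (e x y); rewrite ?mulrN1 ?mulr0.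
Qed.

Lemma laplacian_tr (R : realType) (V : finType) (e : rel V) :
  simple_graph e -> (laplacian R e)^T = laplacian R e.
Proof.
move=> [esym _]; apply/matrixP => i j; rewrite !mxE esym eq_sym.
by case: eqP => [->|].
Qed.

Lemma lap_eigenP (R : realType) (V : finType) (e : rel V) (w : 'rV[R]_#|V|) lam :
  simple_graph e -> (w *m laplacian R e = lam *: w) <->
    lap_eigen e (fun x => w 0 (enum_rank x)) lam.
Proof.
move=> simple_e; split=> [wL x | wL].
  by rewrite -laplacian_mulE // wL mxE.
by apply/rowP => i; rewrite -(enum_valK i) laplacian_mulE // wL mxE.
Qed.

Definition row_of {R : realType} {V : finType} (f : V -> R) : 'rV[R]_#|V| :=
  \row_i f (enum_val i).

Lemma row_ofE (R : realType) (V : finType) (f : V -> R) x :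
  row_of f 0 (enum_rank x) = f x.
Proof. by rewrite mxE enum_rankK. Qed.

Lemma row_of_eigen (R : realType) (V : finType) (e : rel V) (f : V -> R) lam :
  simple_graph e -> lap_eigen e f lam -> row_of f *m laplacian R e = lam *: row_of f.
Proof.
move=> simple_e fL; apply/lap_eigenP => // x.
by under eq_bigr do rewrite !row_ofE; rewrite row_ofE.
Qed.

(** The rows of the projection [P] span the eigenspace and [P] is symmetric, so row [u] is zero
    exactly when column [u] is, that is, when all eigenfunctions vanish at [u]. *)
Lemma eig_supportP (R : realType) (V : finType) (e : rel V) u (lam : R) :
  simple_graph e ->
  eig_support e u lam <-> exists2 f : V -> R, lap_eigen e f lam & f u != 0.
Proof.
move=> simple_e; split=> [[P [[Psym [_ /eqmxP PE]]]]|[f fL fu]].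
  rewrite -rowE => /rowV0Pn [_ /submxP [c ->]].
  case: (altP (row (enum_rank u) P =P 0)) => [->|]; first by rewrite mulmx0 eqxx.
  case/rV0Pn => j; rewrite mxE -Psym mxE => Pju _.
  exists (fun x => row j P 0 (enum_rank x)); last by rewrite mxE.
  by apply/lap_eigenP => //; apply/eigenspaceP; rewrite -PE row_sub.
have [P [Psym [PP PE]]] := orth_proj_eigen_exists (laplacian R e) lam.
exists P; split=> //; rewrite -rowE; apply: contraNneq fu => Pu0.
have : (row_of f <= P)%MS.
  rewrite (eqmxP PE); exact/eigenspaceP/row_of_eigen.
case/submxP => c /matrixP/(_ 0 (enum_rank u)); rewrite row_ofE => ->.
rewrite mxE big1 // => j _; rewrite -Psym mxE.
by have /rowP/(_ j) := Pu0; rewrite !mxE => ->; rewrite mulr0.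
Qed.

(** The left side is the Dirichlet form of [f]; it runs over ordered pairs, so each edge counts
    twice. *)
Lemma lap_eigen_dirichlet (R : realType) (V : finType) (e : rel V) (f : V -> R) lam :
  symmetric e -> lap_eigen e f lam ->
  \sum_x \sum_(y | e x y) (f x - f y) ^+ 2 = lam * (\sum_x f x ^+ 2) *+ 2.
Proof.
move=> esym fL.
have E : \sum_x \sum_(y | e x y) f x * (f x - f y) = lam * \sum_x f x ^+ 2.
  rewrite mulr_sumr; apply: eq_bigr => x _.
  by rewrite -mulr_sumr fL mulrCA expr2.
have E' : \sum_x \sum_(y | e x y) f y * (f y - f x) = lam * \sum_x f x ^+ 2.
  rewrite -E (exchange_big_dep predT) //=.
  by apply: eq_bigr => x _; apply: eq_bigl => y; rewrite esym.
rewrite mulr2n -{1}E -E' -big_split; apply: eq_bigr => x _.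
by rewrite -big_split; apply: eq_bigr => y _ /=; ring.
Qed.

(** Exchanging the endpoints of each edge changes the sign of the sum. *)
Lemma sum_laplacian0 (R : realType) (V : finType) (e : rel V) (f : V -> R) :
  symmetric e -> \sum_x \sum_(y | e x y) (f x - f y) = 0.
Proof.
move=> esym.
suff : \sum_x \sum_(y | e x y) (f x - f y) = - (\sum_x \sum_(y | e x y) (f x - f y)) by lra.
rewrite {1}(exchange_big_dep predT) //= -sumrN; apply: eq_bigr => x _.
rewrite -sumrN; apply: eq_big => [y|y _]; first by rewrite esym.
by rewrite opprB.
Qed.

Lemma lap_eigen_sum0 (R : realType) (V : finType) (e : rel V) (f : V -> R) lam :
  symmetric e -> lap_eigen e f lam -> lam * \sum_x f x = 0.
Proof.
move=> esym fL; rewrite mulr_sumr -[RHS](sum_laplacian0 f esym).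
by apply: eq_bigr => x _; rewrite fL.
Qed.

Lemma lap_eigen_ge0 (R : realType) (V : finType) (e : rel V) (f : V -> R) lam u :
  symmetric e -> lap_eigen e f lam -> f u != 0 -> 0 <= lam.
Proof.
move=> esym fL fu; have S0 : 0 < \sum_x f x ^+ 2.
  rewrite lt_def sumr_ge0 ?andbT => [|x _]; last exact: sqr_ge0.
  apply: contraNneq fu => /eqP; rewrite psumr_eq0 => [/allP/(_ u)|x _]; last exact: sqr_ge0.
  by rewrite mem_index_enum sqrf_eq0 => /(_ isT).
rewrite -(pmulr_lge0 _ S0) -(pmulrn_lge0 _ (isT : (0 < 2)%N)).
rewrite -(lap_eigen_dirichlet esym fL).
by apply: sumr_ge0 => x _; apply: sumr_ge0 => y _; apply: sqr_ge0.
Qed.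

(** The Dirichlet sum is zero, so every square in it is, and [f] does not change along an edge. *)
Lemma lap_eigen0_const (R : realType) (V : finType) (e : rel V) (f : V -> R) x y :
  symmetric e -> lap_eigen e f 0 -> connect e x y -> f x = f y.
Proof.
move=> esym fL; have step a b : e a b -> f a = f b.
  move=> eab; have := lap_eigen_dirichlet esym fL; rewrite mul0r mul0rn => /eqP.
  have sq0 a' : 0 <= \sum_(b' | e a' b') (f a' - f b') ^+ 2.
    by apply: sumr_ge0 => b' _; apply: sqr_ge0.
  rewrite psumr_eq0 // => /allP/(_ a); rewrite mem_index_enum => /(_ isT) /=.
  rewrite psumr_eq0; last by move=> b' _; apply: sqr_ge0.
  move=> /allP/(_ b); rewrite mem_index_enum eab sqrf_eq0 => /(_ isT) /=.
  by rewrite subr_eq0 => /eqP.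
case/connectP => p; elim: p x => [x _ ->//|z p IHp x /= /andP[exz /IHp IH] yE].
by rewrite (step _ _ exz); apply: IH.
Qed.

Lemma lap_eigen1 (R : realType) (V : finType) (e : rel V) :
  lap_eigen e (fun=> 1 : R) 0.
Proof. by move=> x; rewrite mul0r big1 // => y _; rewrite subrr. Qed.

(** * Eigenfunctions of the blow-up *)

Lemma simple_graph_blowup2 (X : finType) (e : rel X) :
  simple_graph e -> simple_graph (blowup2 e).
Proof. by case=> esym eirr; split=> [x y|x]; [exact: esym | exact: eirr]. Qed.

Lemma simple_graph_join (V W : finType) (eG : rel V) (eH : rel W) :
  simple_graph eG -> simple_graph eH -> simple_graph (join eG eH).
Proof.
by move=> [sG iG] [sH iH]; split=> [[x|x] [y|y]|[x|x]] //=; rewrite ?sG ?sH ?iG ?iH.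
Qed.

Lemma sum_blowup2 (R : realType) (X : finType) (e : rel X) (F : 'I_2 * X -> R) p :
  \sum_(q | blowup2 e p q) F q = \sum_(y | e p.2 y) (F (ord0, y) + F (ord_max, y)).
Proof.
transitivity (\sum_(l : 'I_2) \sum_(y | e p.2 y) F (l, y)).
  by rewrite pair_big /=; apply: eq_big => [//|[l y] _].
rewrite big_ord_recl big_ord1 -big_split /=; apply: eq_bigr => y _.
by congr (_ + F (_, _)); apply: val_inj.
Qed.

Lemma lap_eigen_blowup2_sym (R : realType) (X : finType) (e : rel X) (f : X -> R) lam :
  lap_eigen e f lam -> lap_eigen (blowup2 e) (fun p => f p.2) (2 * lam).
Proof.
move=> fL p; rewrite sum_blowup2 /= -mulrA -fL mulr_sumr.
by apply: eq_bigr => y _; ring.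
Qed.

(** As a vector this is [e_(0,u) - e_(1,u)]. *)
Definition signed_delta {R : realType} {X : finType} (u : X) (p : 'I_2 * X) : R :=
  (if p.1 == ord0 then 1 else -1) * (p.2 == u)%:R.

(** The values at the two copies of a neighbour cancel, so only the degree term remains, and degrees
    double in the blow-up. *)
Lemma lap_eigen_blowup2_antisym (R : realType) (X : finType) (e : rel X) (u : X) :
  lap_eigen (blowup2 e) (signed_delta u : _ -> R) (2 * (deg e u)%:R).
Proof.
move=> p; rewrite sum_blowup2 /signed_delta /=; move: (if _ then _ else _) => c.
rewrite (eq_bigr (fun=> 2 * (c * (p.2 == u)%:R))); last by move=> y _; ring.
rewrite sumr_const; case: (p.2 =P u) => [->|_]; last by rewrite !mulr0 mul0rn.
by rewrite /deg cardsE -mulr_natr; ring.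
Qed.

(** The two copies of [x] have the same neighbours: adding their eigenvector equations gives one for
    the symmetric part, and subtracting them leaves only the degree term. *)
Lemma lap_eigen_blowup2_inv (R : realType) (X : finType) (e : rel X)
    (w : 'I_2 * X -> R) mu : lap_eigen (blowup2 e) w mu ->
  lap_eigen e (fun x => w (ord0, x) + w (ord_max, x)) (mu / 2) /\
  forall x, w (ord0, x) != w (ord_max, x) -> mu = 2 * (deg e x)%:R.
Proof.
move=> wL; split=> x.
  have := wL (ord0, x); have := wL (ord_max, x); rewrite !sum_blowup2 /= => E1 E0.
  rewrite mulrDr -!mulrA ![_^-1 * _]mulrC !mulrA -E1 -E0 !mulr_suml -big_split /=.
  by apply: eq_bigr => y _; lra.
have := wL (ord0, x); have := wL (ord_max, x); rewrite !sum_blowup2 /= => E1 E0.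
rewrite -subr_eq0 => d0; apply: (mulIf d0); rewrite mulrBr -E0 -E1 -sumrB.
rewrite (eq_bigr (fun=> 2 * (w (ord0, x) - w (ord_max, x)))); last by move=> y _; ring.
by rewrite sumr_const /deg cardsE -mulr_natr; ring.
Qed.

(** * Perfect state transfer in the blow-up as conditions on cosines *)

Lemma expi_cos1 (R : realType) (x : R) : cos x = 1 -> expi x = 1.
Proof. by move=> cx; rewrite /expi cx cos1sin0 // cx normr1. Qed.

Lemma expi_cosN1 (R : realType) (x : R) : cos x = -1 -> expi x = -1.
Proof.
move=> cx; rewrite /expi cx cos1sin0 ?cx ?normrN1 //.
by apply/eqP; rewrite eq_complex /= oppr0 !eqxx.
Qed.

Lemma row_evec (R : realType) (V : finType) (f : V -> R) a i j :
  (map_mx (real_complex R) (row_of f) *m evec R a) i j = real_complex R (f a).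
Proof. by rewrite !ord1 /evec -colE 2!mxE row_ofE. Qed.

(** Both sides of the transfer equation are paired with the eigenfunction [f], on which the
    exponential acts as a scalar. *)
Lemma expiL_evec_eigen (R : realType) (V : finType) (e : rel V) (f : V -> R) lam
    (t : R) a b g :
  simple_graph e -> lap_eigen e f lam ->
  expiL t (laplacian R e) *m evec R a = g *: evec R b ->
  expi (t * lam) * real_complex R (f a) = g * real_complex R (f b).
Proof.
move=> simple_e /(row_of_eigen simple_e) fL.
move=> /(congr1 (mulmx (map_mx (real_complex R) (row_of f)))).
rewrite mulmxA (expiL_eigenvector _ (laplacian_tr R simple_e) fL).
rewrite -scalemxAl -scalemxAr => /matrixP/(_ 0 0).
by rewrite [LHS]mxE row_evec [RHS]mxE row_evec.
Qed.

Lemma expiL_evec_eq (R : realType) (V : finType) (e : rel V) (t : R) a b :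
  simple_graph e ->
  (forall (f : V -> R) lam, lap_eigen e f lam ->
     expi (t * lam) * real_complex R (f a) = real_complex R (f b)) ->
  expiL t (laplacian R e) *m evec R a = evec R b.
Proof.
move=> simple_e H; apply/eqP; rewrite -subr_eq0; apply/eqP.
apply: (eigenvectors_separate (laplacian_tr R simple_e)) => w lam wL.
pose f x := w 0 (enum_rank x).
have wE : w = row_of f by apply/rowP => i; rewrite mxE /f enum_valK.
have fL : lap_eigen e f lam by apply/lap_eigenP.
rewrite mulmxBr mulmxA (expiL_eigenvector _ (laplacian_tr R simple_e) wL) wE.
rewrite -scalemxAl; apply/matrixP => i j.
by rewrite [LHS]mxE [X in _ + X]mxE [X in X - _]mxE !row_evec H // subrr mxE.
Qed.

Lemma lap_pst_blowup2P (R : realType) (X : finType) (e : rel X) (u : X) (t : R) :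
  simple_graph e ->
  lap_pst (blowup2 e) (ord0, u) (ord_max, u) t <->
  [/\ 0 < t, forall lam, eig_support e u lam -> cos (t * (2 * lam)) = 1
    & cos (t * (2 * (deg e u)%:R)) = -1].
Proof.
move=> simple_e; have simple_b := simple_graph_blowup2 simple_e.
split=> [[t0 [g gE]]|[t0 cos1 cosN1]].
  have g1 : g = 1.
    have := expiL_evec_eigen simple_b (lap_eigen1 R (blowup2 e)) gE.
    by rewrite mulr0 expi_cos1 ?cos0 // mul1r mulr1.
  split=> // [lam /(eig_supportP _ _ simple_e) [f fL fu]|].
    have := expiL_evec_eigen simple_b (lap_eigen_blowup2_sym fL) gE.
    have toCfu : real_complex R (f u) != 0 by rewrite fmorph_eq0.
    by rewrite g1 /= => /(mulIf toCfu)/(congr1 (@complex.Re R)).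
  have := expiL_evec_eigen simple_b (lap_eigen_blowup2_antisym R e u) gE.
  rewrite g1 /signed_delta /= eqxx !mulr1 mul1r.
  by move=> /(congr1 (@complex.Re R)).
split=> //; exists 1; rewrite scale1r; apply: expiL_evec_eq => // w mu wL.
have [pL qL] := lap_eigen_blowup2_inv wL.
have cos_sum : w (ord0, u) + w (ord_max, u) != 0 -> cos (t * mu) = 1.
  move=> pu; rewrite -[RHS](cos1 (mu / 2)); first by congr (cos (t * _)); field.
  by apply/eig_supportP => //; exists (fun x => w (ord0, x) + w (ord_max, x)).
(* If [w] has equal values at the two copies of [u], either they are zero or their sum is nonzero
   and the cosine is 1. Otherwise [mu] is twice the degree of [u] and the cosine is -1. *)
have [AB|AB] := eqVneq (w (ord0, u)) (w (ord_max, u)).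
  have [A0|A0] := eqVneq (w (ord0, u)) 0; first by rewrite -AB A0 rmorph0 mulr0.
  rewrite expi_cos1 ?mul1r ?AB // cos_sum // -AB -mulr2n.
  by rewrite mulrn_eq0 negb_or.
have cosN : cos (t * mu) = -1 by rewrite (qL _ AB).
rewrite expi_cosN1 // mulN1r -rmorphN; congr (real_complex R _).
(* A nonzero sum would make the same cosine equal to 1, so the two values are opposite. *)
apply/eqP; rewrite eq_sym -subr_eq0 opprK addrC; apply/negPn/negP => /cos_sum.
by rewrite cosN; lra.
Qed.

(** * The eigenvalue support in a join *)

Lemma sum_join_l (R : realType) (V W : finType) (eG : rel V) (eH : rel W)
    (F : V + W -> R) x :
  \sum_(q | join eG eH (inl x) q) F q = \sum_(y | eG x y) F (inl y) + \sum_y F (inr y).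
Proof. by rewrite big_sumType. Qed.

Lemma sum_join_r (R : realType) (V W : finType) (eG : rel V) (eH : rel W)
    (F : V + W -> R) x :
  \sum_(q | join eG eH (inr x) q) F q = \sum_y F (inl y) + \sum_(y | eH x y) F (inr y).
Proof. by rewrite big_sumType. Qed.

Lemma deg_join_l (V W : finType) (eG : rel V) (eH : rel W) u :
  deg (join eG eH) (inl u) = (deg eG u + #|W|)%N.
Proof.
rewrite /deg !cardsE -!sum1_card big_sumType /=; congr (_ + _)%N.
Qed.

(** The witnesses are the constants, the function equal to [|W|] on [V] and [-|V|] on [W], and
    zero-sum eigenfunctions of [eG] extended by zero. Conversely, for an eigenvalue other than 0 and
    [|V| + |W|], the restriction to [V] is a zero-sum eigenfunction of [eG]. *)
Lemma eig_support_join (R : realType) (V W : finType) (eG : rel V) (eH : rel W)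
    (u : V) (mu : R) :
  simple_graph eG -> simple_graph eH -> (0 < #|W|)%N ->
  eig_support (join eG eH) (inl u) mu <->
  [\/ mu = 0, mu = (#|V| + #|W|)%:R,
      exists lam, [/\ eig_support eG u lam, lam != 0 & mu = lam + #|W|%:R]
    | ~ connected_graph eG /\ mu = #|W|%:R].
Proof.
move=> simG simH W0; have simJ := simple_graph_join simG simH.
have [symG irrG] := simG; have [symH irrH] := simH.
have m0 : #|V|%:R != 0 :> R by rewrite pnatr_eq0 -lt0n; apply/card_gt0P; exists u.
have n0 : #|W|%:R != 0 :> R by rewrite pnatr_eq0 -lt0n.
pose lift (f : V -> R) (q : V + W) : R := if q is inl x then f x else 0.
have liftL f lam : lap_eigen eG f lam -> \sum_x f x = 0 ->
    lap_eigen (join eG eH) (lift f) (lam + #|W|%:R).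
  move=> fL f0 [x|x].
    rewrite sum_join_l /= fL subr0 sumr_const -mulr_natr; ring.
  rewrite sum_join_r /= mulr0 sumrB sumr_const f0 mul0rn subr0 add0r.
  by rewrite big1 // => y _; rewrite subrr.
split=> [/(eig_supportP _ _ simJ) [F FL Fu]|].
  pose g x := F (inl x); pose h y := F (inr y).
  have Fl x : \sum_(y | eG x y) (g x - g y) + #|W|%:R * g x - \sum_y h y = mu * g x.
    rewrite -[RHS](FL (inl x)) sum_join_l [X in _ = _ + X]sumrB sumr_const.
    by rewrite /g /h -mulr_natr; ring.
  have := lap_eigen_sum0 (proj1 simJ) FL; rewrite big_sumType /= -/g -/h => Fsum.
  have Gsum : #|W|%:R * \sum_x g x - #|V|%:R * \sum_y h y = mu * \sum_x g x.
    rewrite [RHS]mulr_sumr; under [RHS]eq_bigr do rewrite -Fl.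
    rewrite sumrB big_split /= sum_laplacian0 // sumr_const -mulr_sumr.
    by rewrite -mulr_natl; ring.
  have [->|mu0] := eqVneq mu 0; first by constructor 1.
  (* An eigenfunction with [mu] nonzero has total sum zero. If its sum over [V] is nonzero,
     cancelling that sum in [Gsum] gives [mu = |V| + |W|]. *)
  move/eqP: Fsum; rewrite mulf_eq0 (negPf mu0) /= addr_eq0 => /eqP gh.
  have [g0|g0] := eqVneq (\sum_x g x) 0; last first.
    constructor 2; apply: (mulIf g0); rewrite -Gsum natrD.
    by rewrite (_ : \sum_y h y = - \sum_x g x); [ring | lra].
  have h0 : \sum_y h y = 0 by move: gh; rewrite g0; lra.
  have gL : lap_eigen eG g (mu - #|W|%:R).
    by move=> x; rewrite mulrBl -Fl h0; ring.
  have [lam0|lam0] := eqVneq (mu - #|W|%:R) 0; last first.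
    constructor 3; exists (mu - #|W|%:R); split=> //; last by rewrite subrK.
    by apply/eig_supportP => //; exists g.
  constructor 4; split; last by apply/eqP; rewrite -subr_eq0 lam0.
  move=> conG; rewrite lam0 in gL.
  (* On a connected graph [g] would be constant with sum zero, against its nonzero value at [u]. *)
  have gu x : g x = g u by apply: (lap_eigen0_const symG gL); exact: conG.
  move/eqP: g0; under eq_bigr do rewrite gu.
  by rewrite sumr_const -mulr_natl mulf_eq0 (negPf m0) (negPf Fu).
case=> [->|->|[lam [/(eig_supportP _ _ simG) [f fL fu] lam0 ->]]|[ncon ->]];
  apply/eig_supportP => //.
- by exists (fun=> 1); [exact: lap_eigen1 | exact: oner_neq0].
- exists (fun q => if q is inl _ then #|W|%:R else - #|V|%:R) => // -[x|x].
    rewrite sum_join_l big1 => [|y _]; last by rewrite subrr.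
    by rewrite sumr_const -mulr_natl natrD; ring.
  rewrite sum_join_r [X in _ + X]big1 => [|y _]; last by rewrite subrr.
  by rewrite sumr_const -mulr_natl natrD; ring.
- exists (lift f) => //; apply: liftL => //.
  by have /eqP := lap_eigen_sum0 symG fL; rewrite mulf_eq0 (negPf lam0) => /eqP.
(* The indicator of the component of [u], minus the density [c] of that component, has sum zero and
   is constant on components. *)
pose c : R := #|connect eG u|%:R / #|V|%:R.
exists (lift (fun x => (connect eG u x)%:R - c)).
  rewrite -[X in lap_eigen _ _ X]add0r; apply: liftL => [x|].
    rewrite mul0r big1 // => y xy.
    have -> : connect eG u y = connect eG u x.
      by apply: (same_connect_r (sym_connect_sym symG)); rewrite connect1 // symG.
    by rewrite subrr.
  rewrite sumrB sumr_const -mulr_natl mulrC divfK // -natr_sum.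
  rewrite (_ : \sum_x _ = #|connect eG u|)%N ?subrr //.
  by rewrite -sum1_card [RHS]big_mkcond.
(* The value at [u] is [1 - c], which is zero only if the component is all of [V]. *)
rewrite /= connect0 subr_eq0 eq_sym /c; apply/negP => /eqP/(congr1 ( *%R^~ #|V|%:R)).
rewrite divfK // mul1r => /eqP; rewrite eqr_nat => /eqP cV; apply: ncon => x y.
have all_u z : connect eG u z.
  by have := subset_cardP cV (subset_predT _) z; rewrite !inE.
apply: connect_trans (all_u y); by rewrite (sym_connect_sym symG).
Qed.

(** * The parity condition on the time *)

(** Reduction modulo [2 pi] leaves [r] in [[0, 2 pi)]. The half-angle formula gives
    [sin (r / 2) = 0], while sine is positive inside [(0, pi)], so [r = 0]. *)
Lemma cos_eq1_ge0 (R : realType) (x : R) : 0 <= x ->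
  cos x = 1 <-> exists k : nat, x = (pi *+ 2) *+ k.
Proof.
move=> x0; have pi0 := pi_gt0 R; split=> [cx|[k ->]]; last first.
  by rewrite -[_ *+ k]add0r (periodicn (@cosD2pi R)) cos0.
have p2 : 0 < pi *+ 2 :> R by rewrite mulrn_wgt0.
exists (Num.truncn (x / (pi *+ 2))); set k := Num.truncn _.
have /andP[kl kr] : k%:R <= x / (pi *+ 2) < k.+1%:R.
  by apply: truncn_itv; rewrite divr_ge0 // ltW.
rewrite ler_pdivlMr // in kl; rewrite ltr_pdivrMr // in kr.
pose r := x - (pi *+ 2) *+ k; have xE : x = r + (pi *+ 2) *+ k by rewrite subrK.
have r0 : 0 <= r by rewrite subr_ge0 -mulr_natl.
have r2 : r < pi *+ 2 by rewrite ltrBlDr -mulrS -mulr_natl.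
have cr : cos r = 1 by move: cx; rewrite xE (periodicn (@cosD2pi R)).
have sr : sin (r / 2) = 0.
  apply/eqP; rewrite -sqrf_eq0; apply/eqP.
  have : cos (r / 2 + r / 2) = 1 by rewrite -splitr.
  by rewrite cosD -!expr2 cos2sin2; lra.
suff r00 : r = 0 by rewrite [LHS]xE r00 add0r.
apply/eqP; move: r0; rewrite le_eqVlt => /orP[/eqP <- //|r0].
have : 0 < sin (r / 2) by apply: sin_gt0_pi; apply/andP; split; lra.
by rewrite sr ltxx.
Qed.

Lemma cos_eqN1_ge0 (R : realType) (x : R) : 0 <= x ->
  cos x = -1 <-> exists k : nat, x = pi *+ k.*2.+1.
Proof.
move=> x0; have pi0 := pi_gt0 R.
have xpi0 : 0 <= x + pi by lra.
have piE k : pi *+ 2 *+ k.+1 = pi *+ k.*2.+1 + pi :> R.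
  by rewrite -mulrnA -mulrSr mul2n doubleS.
split=> [cx|[k kE]].
  have /(cos_eq1_ge0 xpi0) [[|k] xE] : cos (x + pi) = 1 by rewrite cosDpi cx opprK.
    by rewrite mulr0n in xE; lra.
  by exists k; apply: (addIr pi); rewrite xE piE.
apply: oppr_inj; rewrite -cosDpi opprK; apply/(cos_eq1_ge0 xpi0).
by exists k.+1; rewrite piE kE.
Qed.

(** For [T] the support and [d] the degree of [u], transfer in the blow-up occurs
    at time [t] iff [s = 2 t / pi] satisfies this condition. *)
Definition parity_time {R : realType} (T : R -> Prop) (d : nat) (s : R) : Prop :=
  [/\ 0 < s, forall x, T x -> exists k : nat, s * x = k.*2%:R
    & exists k : nat, s * d%:R = k.*2.+1%:R].

Lemma eig_support_ge0 (R : realType) (V : finType) (e : rel V) u (lam : R) :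
  simple_graph e -> eig_support e u lam -> 0 <= lam.
Proof.
move=> simple_e /(eig_supportP _ _ simple_e) [f].
by move=> /(lap_eigen_ge0 simple_e.1); apply.
Qed.

Lemma eig_support0 (R : realType) (V : finType) (e : rel V) u :
  simple_graph e -> eig_support e u (0 : R).
Proof.
move=> simple_e; apply/eig_supportP => //.
by exists (fun=> 1); [exact: lap_eigen1 | exact: oner_neq0].
Qed.

Lemma lap_pst_parity_time (R : realType) (X : finType) (e : rel X) (u : X) (t : R) :
  simple_graph e ->
  lap_pst (blowup2 e) (ord0, u) (ord_max, u) t <->
  parity_time (eig_support e u) (deg e u) (2 * t / pi).
Proof.
move=> simple_e; have pi0 := pi_gt0 R; have pin0 : pi != 0 :> R by rewrite gt_eqF.
have sE (x y : R) : t * (2 * x) = pi * y <-> 2 * t / pi * x = y.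
  move: (pi : R) pin0 => p p0; split=> [E|<-]; last by field.
  by apply: (mulfI p0); rewrite -E; field.
rewrite (lap_pst_blowup2P _ _ simple_e) /parity_time.
have -> : (0 < 2 * t / pi) = (0 < t) by rewrite pmulr_lgt0 ?invr_gt0 // pmulr_rgt0.
split=> -[t0 Teven dodd]; split=> //.
- move=> x Tx; have x0 := eig_support_ge0 simple_e Tx.
  have /cos_eq1_ge0[|k kE] := Teven x Tx; first by rewrite !mulr_ge0 // ltW.
  by exists k; apply/sE; rewrite kE -mulrnA mul2n mulr_natr.
- have /cos_eqN1_ge0[|k kE] := dodd; first by rewrite !mulr_ge0 // ltW.
  by exists k; apply/sE; rewrite kE mulr_natr.
- move=> x Tx; have x0 := eig_support_ge0 simple_e Tx.
  apply/cos_eq1_ge0; first by rewrite !mulr_ge0 // ltW.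
  by have [k /sE ->] := Teven x Tx; exists k; rewrite -mulrnA mul2n mulr_natr.
- apply/cos_eqN1_ge0; first by rewrite !mulr_ge0 // ltW.
  by have [k /sE ->] := dodd; exists k; rewrite mulr_natr.
Qed.

(** * Integrality and 2-adic valuations of the support *)

(** The root is an algebraic integer, and a rational algebraic integer is an integer. *)
Lemma rat_root_monic_int (p : {poly int}) (r : rat) :
  p \is monic -> root (map_poly intr p) r -> r \is a Num.int.
Proof.
move=> pmonic pr.
have : (ratr r : algC) \in Aint.
  apply: (@root_monic_Aint (map_poly intr p)).
  - rewrite -(fmorph_root (ratr : {rmorphism rat -> algC})) -map_poly_comp in pr.
    by rewrite (eq_map_poly (fun z => esym (ratr_int _ z))).
  - by rewrite monic_map.
  - by apply/polyOverP => i; rewrite coef_map /= intr_int.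
move=> /(Cint_rat_Aint (Crat_rat r)) /intrP [z].
by rewrite -(ratr_int _ z) => /fmorph_inj ->; exact: intr_int.
Qed.

(** The characteristic polynomial of the Laplacian is monic with integer coefficients, so rational
    eigenvalues are integers; those in the support are nonnegative. *)
Lemma eig_support_rat_nat (R : realType) (V : finType) (e : rel V) u (r : rat) :
  simple_graph e -> eig_support e u (ratr r : R) -> exists n : nat, ratr r = n%:R :> R.
Proof.
move=> simple_e rsupp; have r0 := eig_support_ge0 simple_e rsupp.
have [f fL fu] := (eig_supportP _ _ simple_e).1 rsupp.
pose A : 'M[int]_#|V| := \matrix_(i, j) (if i == j then (deg e (enum_val i))%:R
                  else if e (enum_val i) (enum_val j) then -1 else 0).
have LA : laplacian R e = map_mx intr A.
  apply/matrixP => i j; rewrite !mxE; case: (i == j); first by rewrite rmorph_nat.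
  by case: (e _ _); rewrite ?rmorphN1 ?rmorph0.
have : eigenvalue (laplacian R e) (ratr r).
  apply/eigenvalueP; exists (row_of f); first exact: row_of_eigen.
  by apply: contraNneq fu => f0; rewrite -row_ofE f0 mxE.
rewrite eigenvalue_root_char LA -map_char_poly.
rewrite (eq_map_poly (fun z => esym (ratr_int _ z))) map_poly_comp fmorph_root.
move/(rat_root_monic_int (char_poly_monic A)) => /intrP [[n|n] rE]; last first.
  by move: r0; rewrite rE ratr_int ler0z.
by exists n; rewrite rE ratr_int.
Qed.

(** Dividing [s x = 2 j] by [s d = 2 k + 1] eliminates [s] and exhibits [x] as rational. *)
Lemma parity_time_support_nat (R : realType) (V : finType) (e : rel V) u d (s x : R) :
  simple_graph e -> parity_time (eig_support e u) d s ->
  eig_support e u x -> exists n : nat, x = n%:R.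
Proof.
move=> simple_e [s0 /(_ x) Teven [k kE]] Tx; have [j jE] := Teven Tx.
have xE : x = ratr ((j.*2 * d)%:R / k.*2.+1%:R).
  rewrite fmorph_div !rmorph_nat natrM -jE -kE.
  have d0 : d%:R != 0 :> R.
    by apply: contra_eq_neq kE => ->; rewrite mulr0 eq_sym pnatr_eq0.
  by field; rewrite d0 gt_eqF.
by rewrite xE in Tx *; apply: eig_support_rat_nat Tx.
Qed.

(** Eliminating [s] gives [2 j d = (2 k + 1) n], where the odd factor has valuation zero. *)
Lemma parity_time_logn (R : realType) (T : R -> Prop) d (s : R) n :
  (0 < d)%N -> parity_time T d s -> T n%:R -> (0 < n)%N -> (logn 2 d < logn 2 n)%N.
Proof.
move=> d0 [s0 Teven [k kE]] /Teven [j jE] n0.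
have E : (j.*2 * d = k.*2.+1 * n)%N.
  by apply/eqP; rewrite -(eqr_nat R) !natrM -jE -kE; apply/eqP; ring.
have j0 : (0 < j)%N.
  by case: j E {jE} => // /esym/eqP; rewrite muln_eq0 /= => /eqP n00; rewrite n00 in n0.
have odd0 : logn 2 k.*2.+1 = 0%N by rewrite lognE dvdn2 /= odd_double.
have /(congr1 (logn 2)) := E; rewrite -mul2n !lognM ?muln_gt0 ?j0 // odd0 add0n => <-.
by rewrite -[X in (X < _)%N]add0n ltn_add2r addn_gt0 logn_prime.
Qed.

(** * The gcd of a set and the minimum time *)

Lemma divides_real_nat (R : realType) d n : divides_real d (n%:R : R) <-> (d %| n)%N.
Proof.
split=> [[k /eqP]|/dvdnP [q ->]]; last by exists q%:Z; rewrite natrM.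
rewrite -[n%:R]/(n%:Z%:~R) -[d%:R]/(d%:Z%:~R) -intrM eqr_int => /eqP E.
by have := congr1 absz E; rewrite abszM /= => ->; rewrite dvdn_mull.
Qed.

(** Every common divisor divides [d], so there are finitely many; their lcm again divides every
    element of [S]. *)
Lemma gcd_set_exists (R : realType) (S : R -> Prop) d :
  (0 < d)%N -> S d%:R -> (forall x, S x -> exists n : nat, x = n%:R) ->
  exists2 h : nat, (0 < h)%N & is_gcd_set S h.
Proof.
move=> d0 Sd Snat.
pose common i := `[< forall x, S x -> divides_real i x >].
pose h := \big[lcmn/1%N]_(i <- divisors d | common i) i.
have hdiv x : S x -> divides_real h x.
  move=> Sx; have [n xE] := Snat x Sx; rewrite xE; apply/divides_real_nat.
  rewrite /h; elim/big_ind: _ => [|a b an bn|i /asboolP ci]; first exact: dvd1n.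
    by rewrite dvdn_lcm an.
  by apply/(divides_real_nat R); rewrite -xE; apply: ci.
exists h; first by apply: dvdn_gt0 d0 _; apply/(divides_real_nat R)/hdiv.
split=> // i ci; have id : (i %| d)%N by apply/(divides_real_nat R)/ci.
rewrite /h -big_filter (bigD1_seq i) ?filter_uniq ?divisors_uniq //=; last first.
  by rewrite mem_filter -dvdn_divisors // id andbT; exact/asboolP.
by rewrite dvdn_lcml.
Qed.

(** The power of 2 in [d] divides all of [S], so the gcd [h] has the same 2-adic valuation as [d].
    Hence [d / h] is odd and [x / h] is even for every [x] in [T], which makes [1 / h]
    admissible. *)
Lemma parity_time_min (R : realType) (T S : R -> Prop) d :
  (0 < d)%N ->
  (forall x, T x -> exists2 n : nat, x = n%:R & (0 < n)%N -> (logn 2 d < logn 2 n)%N) ->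
  (forall x, S x <-> x = d%:R \/ (T x /\ x != 0)) ->
  exists h : nat, [/\ (0 < h)%N, is_gcd_set S h, parity_time T d h%:R^-1
    & forall s, parity_time T d s -> h%:R^-1 <= s].
Proof.
move=> d0 Tnat SE.
have Sd : S d%:R by apply/SE; left.
have Snat x : S x -> exists n : nat, x = n%:R.
  by case/SE => [->|[/Tnat [n xE _] _]]; [exists d | exists n].
have [h h0 [hdiv hmax]] := gcd_set_exists d0 Sd Snat.
have hR0 : h%:R != 0 :> R by rewrite pnatr_eq0 -lt0n.
have hd : (h %| d)%N by apply/(divides_real_nat R)/hdiv.
have lognh : logn 2 h = logn 2 d.
  apply/eqP; rewrite eqn_leq dvdn_leq_log //= -pfactor_dvdn //; apply: hmax => x.
  case/SE => [->|[/Tnat [n -> ln] n0]]; apply/divides_real_nat.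
    exact: pfactor_dvdnn.
  rewrite pnatr_eq0 -lt0n in n0.
  by rewrite pfactor_dvdn // ltnW // ln.
exists h; split=> //; first split.
- by rewrite invr_gt0 ltr0n.
- move=> x Tx; have [n xE ln] := Tnat x Tx.
  case: (posnP n) => [n0|n0]; first by exists 0%N; rewrite xE n0 mulr0.
  have Sx : S x by apply/SE; right; split=> //; rewrite xE pnatr_eq0 -lt0n.
  have /divides_real_nat/dvdnP [q nE] : divides_real h (n%:R : R) by rewrite -xE; apply: hdiv.
  have q0 : (0 < q)%N by move: n0; rewrite nE muln_gt0 => /andP[].
  have : (0 < logn 2 q)%N.
    by move: (ln n0); rewrite nE lognM // lognh -[X in (X < _)%N]add0n ltn_add2r.
  rewrite -pfactor_dvdn // dvdn2 => /even_halfK qE.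
  by exists q./2; rewrite qE xE nE natrM mulrC mulfK.
- have /dvdnP [q dE] := hd.
  have q0 : (0 < q)%N by move: d0; rewrite dE muln_gt0 => /andP[].
  have : logn 2 q = 0%N.
    by apply/eqP; move/eqP: lognh; rewrite dE lognM // -[X in X == _]add0n eqn_add2r eq_sym.
  move/eqP; rewrite eqn0Ngt -pfactor_dvdn // dvdn2 negbK => /odd_halfK qE.
  by exists q./2; rewrite {1}dE natrM mulrC mulfK // qE prednK //.
move=> s [s0 Teven [k kE]]; set a := k.*2.+1 in kE.
have dR0 : d%:R != 0 :> R by rewrite pnatr_eq0 -lt0n.
have g0 : (0 < gcdn a d)%N by rewrite gcdn_gt0.
have /dvdnP [a' aE] := dvdn_gcdl a d; have /dvdnP [q dE] := dvdn_gcdr a d.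
set g := gcdn a d in g0 aE dE.
have a'q : coprime a' q.
  by rewrite /coprime -(eqn_pmul2r g0) mul1n muln_gcdl -aE -dE.
have q0 : (0 < q)%N by move: d0; rewrite dE muln_gt0 => /andP[].
have a'0 : (0 < a')%N by have : (0 < a)%N by []; rewrite aE muln_gt0 => /andP[].
have sq : s * q%:R = a'%:R.
  have gR0 : g%:R != 0 :> R by rewrite pnatr_eq0 -lt0n.
  by apply: (mulIf gR0); rewrite -mulrA -!natrM -dE -aE.
have qR0 : q%:R != 0 :> R by rewrite pnatr_eq0 -lt0n.
(* In lowest terms [s = a' / q], and [q] divides every element of [S] by Gauss,
   so [q] divides the gcd [h]. *)
have /hmax/dvdnP [c hE] : forall x, S x -> divides_real q x.
  move=> x /SE [->|[Tx _]]; first by apply/divides_real_nat; rewrite dE dvdn_mulr.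
  have [n xE _] := Tnat x Tx; have [j jE] := Teven x Tx.
  rewrite xE; apply/divides_real_nat.
  rewrite -(Gauss_dvdr n (_ : coprime q a')) 1?coprime_sym //.
  apply/dvdnP; exists j.*2; apply/eqP; rewrite -(eqr_nat R) !natrM -sq -jE xE.
  by apply/eqP; ring.
have c0 : (0 < c)%N by move: h0; rewrite hE muln_gt0 => /andP[].
(* Since [h = c q] and [s q = a'], the product [s h = c a'] is a positive natural number. *)
rewrite -[_^-1]mul1r ler_pdivrMr ?ltr0n // hE natrM mulrCA sq -natrM ler1n.
by rewrite muln_gt0 c0.
Qed.

(** * Transfer in the blow-up of a join *)

Theorem theorem7 (R : realType) (V W : finType) (eG : rel V) (eH : rel W)
  (simpleG : simple_graph eG) (simpleH : simple_graph eH)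
  (W_nonempty : (0 < #|W|)%N) (u : V)
  (du_notin : ~ eig_support eG u ((deg eG u)%:R : R)) :
  let m := #|V| in
  let n := #|W| in
  let du := deg eG u in
  let sig := fun lam : R => eig_support eG u lam in
  let X := blowup2 (join eG eH) in
  let a := ((ord0 : 'I_2), (inl u : (V + W)%type)) in
  let b := ((ord_max : 'I_2), (inl u : (V + W)%type)) in
  let cond1 :=
    [/\ connected_graph eG,
        (nu2 (du + n)%:Z < nu2 (m + n)%:Z)%N
      & forall k : int, sig k%:~R -> k != 0 ->
          (nu2 (du + n)%:Z < nu2 (k + n%:Z))%N] in
  let cond2 :=
    [/\ ~ connected_graph eG,
        (exists v, eG u v),
        (nu2 (du + n)%:Z < nu2 n%:Z)%N,
        (nu2 (du + n)%:Z < nu2 (m + n)%:Z)%N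
      & forall k : int, sig k%:~R -> k != 0 ->
          (nu2 (du + n)%:Z < nu2 (k + n%:Z))%N] in
  let S1 := fun s : R => exists lam : R,
    ((sig lam /\ lam != 0) \/ lam = du%:R \/ lam = m%:R) /\ s = lam + n%:R in
  let S2 := fun s : R => exists lam : R,
    (sig lam \/ lam = du%:R \/ lam = m%:R) /\ s = lam + n%:R in
  ((exists t : R, lap_pst X a b t) <->
     ((forall lam, sig lam -> lam \is a Num.int) /\ (cond1 \/ cond2))) /\
  ((exists t : R, lap_pst X a b t) ->
     (cond1 -> exists h : nat, is_gcd_set S1 h /\
                 min_pst_time X a b ((pi : R) / (2 * h%:R))) /\
     (~ cond1 -> exists h : nat, is_gcd_set S2 h /\
                 min_pst_time X a b ((pi : R) / (2 * h%:R)))).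

Proof.
move=> m n du sig X a b cond1 cond2 S1 S2.
have simJ := simple_graph_join simpleG simpleH.
set T := eig_support (join eG eH) (inl u) : R -> Prop.
have d0 : (0 < du + n)%N by rewrite addn_gt0 W_nonempty orbT.
have m0 : (0 < m)%N by apply/card_gt0P; exists u.
have pstE t : lap_pst X a b t <-> parity_time T (du + n) (2 * t / pi).
  by rewrite -(deg_join_l eG eH); exact: lap_pst_parity_time.
have TE (mu : R) := eig_support_join u mu simpleG simpleH W_nonempty.
have sig_ge0 lam : sig lam -> 0 <= lam by exact: eig_support_ge0.
have T_mn : T (m + n)%:R by apply/TE; constructor 2.
have T_sig lam : sig lam -> lam != 0 -> T (lam + n%:R).
  by move=> sl l0; apply/TE; constructor 3; exists lam.
have necessary (t : R) : lap_pst X a b t ->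
    (forall lam, sig lam -> lam \is a Num.int) /\ (cond1 \/ cond2).
  move=> /pstE pt; have Tnat x := parity_time_support_nat (x := x) simJ pt.
  have Tlogn k := parity_time_logn (n := k) d0 pt.
  have nu_sig (k : int) : sig k%:~R -> k != 0 -> (nu2 (du + n)%:Z < nu2 (k + n%:Z))%N.
    move=> sk k0; have Tk := T_sig _ sk; rewrite intr_eq0 in Tk.
    have [j jE] := Tnat _ (Tk k0).
    have kE : k + n%:Z = j%:Z by apply/eqP; rewrite -(eqr_int R) intrD; apply/eqP.
    rewrite kE /nu2 /=; apply: Tlogn; first by rewrite -jE; exact: Tk.
    have := sig_ge0 _ sk; rewrite ler0z => k_ge0.
    by rewrite -ltz_nat -kE ltr_wpDl.
  have nu_mn : (nu2 (du + n)%:Z < nu2 (m + n)%:Z)%N.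
    by apply: Tlogn => //; rewrite addn_gt0 m0.
  split=> [lam sl|].
    have [->|l0] := eqVneq lam 0; first exact: rpred0.
    have [j jE] := Tnat _ (T_sig _ sl l0).
    by rewrite -[lam](addrK n%:R) jE rpredB // intr_nat.
  have [con|ncon] := pselect (connected_graph eG); [by left | right].
  have nu_n : (nu2 (du + n)%:Z < nu2 n%:Z)%N.
    by apply: Tlogn => //; apply/TE; constructor 4.
  (* If [u] were isolated, then [du = 0] and [nu_n] would compare a valuation strictly with
     itself. *)
  split=> //; apply/existsP; apply: contraLR nu_n; rewrite negb_exists => /forallP iso.
  suff -> : du = 0%N by rewrite ltnn.
  by apply: eq_card0 => v; rewrite inE; exact/negbTE/iso.
(* Conversely, the conditions make each element of [T] a natural number with the valuation that
   [parity_time_min] requires. *)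
have Tgood : (forall lam, sig lam -> lam \is a Num.int) -> cond1 \/ cond2 ->
    forall x, T x -> exists2 k : nat, x = k%:R & (0 < k)%N -> (logn 2 (du + n) < logn 2 k)%N.
  move=> sigZ cond x /TE.
  have nu_mn : (nu2 (du + n)%:Z < nu2 (m + n)%:Z)%N by case: cond => -[].
  have nu_sig (k : int) : sig k%:~R -> k != 0 -> (nu2 (du + n)%:Z < nu2 (k + n%:Z))%N.
    by case: cond => [[_ _]|[_ _ _ _]]; apply.
  case=> [->|->|[lam [sl l0 ->]]|[ncon ->]].
  - by exists 0%N.
  - by exists (m + n)%N.
  - have /intrP [k kE] := sigZ _ sl; rewrite kE intr_eq0 in sl l0 *.
    have := sig_ge0 _ sl; rewrite ler0z; case: k {kE} sl l0 => // k sk k0 _.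
    by exists (k + n)%N; [rewrite natrD | move=> _; exact: nu_sig sk k0].
  (* This eigenvalue [n] comes from a disconnected [G], where [cond2] supplies its valuation. *)
  - exists n => // _; case: cond => [[/ncon //]|[_ _ nu_n _ _]]; exact: nu_n.
(* The time [pi / (2 h)] corresponds to the parameter [1 / h] of [parity_time]. *)
have pst_at h : (0 < h)%N -> 2 * (pi / (2 * h%:R)) / pi = h%:R^-1 :> R.
  move=> h0; have hR0 : h%:R != 0 :> R by rewrite pnatr_eq0 -lt0n.
  by move: (pi : R) (pi_gt0 R) => p /gt_eqF p0; field; rewrite p0 hR0.
(* Both claims on the minimum time are instances of this one, once [S1] or [S2] is described in
   terms of [T]. *)
have min_pst (S : R -> Prop) :
    (forall lam, sig lam -> lam \is a Num.int) -> cond1 \/ cond2 ->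
    (forall x, S x <-> x = (du + n)%:R \/ (T x /\ x != 0)) ->
    exists h : nat, is_gcd_set S h /\ min_pst_time X a b ((pi : R) / (2 * h%:R)).
  move=> sigZ cond SE.
  have [h [h0 hgcd hpt hmin]] := parity_time_min d0 (Tgood sigZ cond) SE.
  exists h; split=> //; split=> [|s s0 sh /(pstE s).1 ps].
    by apply: (pstE _).2; rewrite pst_at.
  have := hmin _ ps; rewrite leNgt -(pst_at h h0) => /negP; apply.
  by rewrite ltr_pM2r ?invr_gt0 ?pi_gt0 // ltr_pM2l.
have S_nonzero lam : 0 <= lam -> lam + n%:R != 0 :> R.
  by move=> l0; rewrite gt_eqF // ltr_wpDl // ltr0n.
split; first split=> [[t /necessary //]|[sigZ cond]].
  (* For existence, [S] is the described set itself. *)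
  have [h [_ [pst _]]] := min_pst _ sigZ cond (fun x => iff_refl _).
  by exists (pi / (2 * h%:R)).
move=> [t /necessary [sigZ cond]]; split=> c1; apply: min_pst => // x; split.
- case=> lam [[[sl l0]|[->|->]] ->]; last first.
  + by right; rewrite -natrD; split=> //; rewrite natrD S_nonzero.
  + by left; rewrite natrD.
  + by right; split; [exact: T_sig | apply: S_nonzero; exact: sig_ge0].
- case=> [->|[/TE Tx x0]]; first by exists du%:R; split; [right; left | rewrite natrD].
  case: Tx x0 => [->|->|[lam [sl l0 ->]]|[ncon _]] x0.
  + by rewrite eqxx in x0.
  + by exists m%:R; split; [right; right | rewrite natrD].
  + by exists lam; split; [left |].
  (* Connectedness excludes the eigenvalue [n = 0 + n], in accordance with [S1] leaving out
     [lam = 0]. *)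
  + by case: c1 => /ncon.
- case=> lam [[sl|[->|->]] ->]; last first.
  + by right; rewrite -natrD; split=> //; rewrite natrD S_nonzero.
  + by left; rewrite natrD.
  right; split; last by apply: S_nonzero; exact: sig_ge0.
  (* For [lam = 0] the element is [n], which lies in [T] because without [cond1] only [cond2]
     remains, and there [G] is disconnected. *)
  have [l0|l0] := eqVneq lam 0; last exact: T_sig.
  by apply/TE; constructor 4; rewrite l0 add0r; case: cond => // -[].
- case=> [->|[/TE Tx x0]]; first by exists du%:R; split; [right; left | rewrite natrD].
  case: Tx x0 => [->|->|[lam [sl l0 ->]]|[ncon ->]] x0.
  + by rewrite eqxx in x0.
  + by exists m%:R; split; [right; right | rewrite natrD].
  + by exists lam; split; [left |].
  + by exists 0; split; [left; exact: eig_support0 | rewrite add0r].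
Qed.
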